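(* Let $\overline{A_1A_2A_3}$ be a triangle in the Euclidean plane $\mathbb{R}^2$ with spreads $s_1,s_2,s_3$. Then $$\left(s_1+s_2+s_3\right)^{2}=2\left(s_1^{2}+s_2^{2}+s_3^{2}\right)+4s_1s_2s_3.$$
   Context: The quadrance between points $A=[x_1,y_1]$ and $B=[x_2,y_2]$ of the real Euclidean plane is $Q(A,B)=(x_2-x_1)^2+(y_2-y_1)^2$. The spread $s(l_1,l_2)$ between two lines $l_1,l_2$ is defined as follows. If $l_1$ and $l_2$ are parallel, $s(l_1,l_2)=0$. If they intersect at a point $A$, choose a point $B\neq A$ on $l_1$ and let $C$ be the foot of the perpendicular from $B$ to $l_2$; then $s(l_1,l_2)=Q(B,C)/Q(A,B)$, which is independent of the choice of $B$ (perpendicular lines have spread $1$). Equivalently, if the lines have equations $a_1x+b_1y+c_1=0$ and $a_2x+b_2y+c_2=0$, then $s(l_1,l_2)=\dfrac{(a_1b_2-a_2b_1)^2}{(a_1^2+b_1^2)(a_2^2+b_2^2)}$. A triangle $\overline{A_1A_2A_3}$ is given by three non-collinear points. Its spreads are $s_1=s(A_1A_2,A_1A_3)$, $s_2=s(A_2A_1,A_2A_3)$, $s_3=s(A_3A_1,A_3A_2)$, where $A_iA_j$ denotes the line through $A_i$ and $A_j$ (so $s_i$ is the spread at vertex $A_i$). *)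

(* Defs.v *)
From mathcomp Require Import all_boot all_order all_algebra.
From mathcomp Require Import boolp classical_sets reals.

Set Implicit Arguments.
Unset Strict Implicit.
Unset Printing Implicit Defensive.

Import Order.TTheory GRing.Theory Num.Theory.
Local Open Scope classical_set_scope.
Local Open Scope ring_scope.

Definition plane (R : realType) : Type := (R * R)%type.

Definition quadrance (R : realType) (A B : plane R) : R :=
  (B.1 - A.1) ^+ 2 + (B.2 - A.2) ^+ 2.

(* A genuine line only when A <> B; line_through A A is the singleton A. *)
Definition line_through (R : realType) (A B : plane R) : set (plane R) :=
  [set P | exists t : R,
    P = (A.1 + t * (B.1 - A.1), A.2 + t * (B.2 - A.2))].

Definition is_line (R : realType) (l : set (plane R)) : Prop :=
  exists A B : plane R, A <> B /\ l = line_through A B.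

Definition collinear (R : realType) (A B C : plane R) : Prop :=
  exists l : set (plane R), [/\ is_line l, l A, l B & l C].

(* A line is parallel to itself. *)
Definition parallel (R : realType) (l1 l2 : set (plane R)) : Prop :=
  l1 = l2 \/ l1 `&` l2 = set0.

(* Orthogonality is expressed by scalar products, so that C = B is allowed
   when B already lies on l. *)
Definition perp_foot (R : realType) (B : plane R) (l : set (plane R))
    (C : plane R) : Prop :=
  l C /\ forall D : plane R, l D ->
    (B.1 - C.1) * (D.1 - C.1) + (B.2 - C.2) * (D.2 - C.2) = 0.

Definition is_spread (R : realType) (l1 l2 : set (plane R)) (s : R) : Prop :=
  (parallel l1 l2 /\ s = 0) \/
  (~ parallel l1 l2 /\
   exists A B C : plane R,
     [/\ l1 A /\ l2 A, l1 B /\ B <> A, perp_foot B l2 C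
       & s = quadrance B C / quadrance A B]).

(* For two lines, exactly one s satisfies is_spread l1 l2 s, whichever point B
   is chosen; the default value 0 matters only for sets that are not lines. *)
Definition spread (R : realType) (l1 l2 : set (plane R)) : R :=
  xget 0 [set s | is_spread l1 l2 s].

(* Main.v *)
Require Import Defs.
From mathcomp Require Import all_boot all_order all_algebra.
From mathcomp Require Import boolp classical_sets reals.
From mathcomp Require Import ring.

Set Implicit Arguments.
Unset Strict Implicit.

Import Order.TTheory GRing.Theory Num.Theory.
Local Open Scope ring_scope.

(** Let [Qi] be the quadrance of the side opposite to [Ai] and let [K] be twice
    the signed area of the triangle. Dropping a perpendicular gives the spread
    at a vertex as the squared cross product of its two sides over the product
    of their quadrances ([spread_at_vertex]); this cross product is [K] up to
    sign at all three vertices. Hence [si = d * Qi] with the single factor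
    [d = K ^+ 2 / (Q1 * Q2 * Q3)], which is the law of sines for spreads.
    Archimedes' form of Heron's formula ([archimedes_formula]),
      [(Q1 + Q2 + Q3) ^+ 2 = 2 * (Q1 ^+ 2 + Q2 ^+ 2 + Q3 ^+ 2) + 4 * K ^+ 2],
    multiplied by [d ^+ 2], is then the claim, because
    [s1 * s2 * s3 = d ^+ 3 * (Q1 * Q2 * Q3) = d ^+ 2 * K ^+ 2]. *)

Definition twice_signed_area (R : realType) (A B C : plane R) : R :=
  (B.1 - A.1) * (C.2 - A.2) - (B.2 - A.2) * (C.1 - A.1).

Lemma twice_signed_area_swap (R : realType) (A B C : plane R) :
  twice_signed_area B A C = - twice_signed_area A B C.
Proof. by rewrite /twice_signed_area; ring. Qed.

Lemma twice_signed_area_rot (R : realType) (A B C : plane R) :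
  twice_signed_area C A B = twice_signed_area A B C.
Proof. by rewrite /twice_signed_area; ring. Qed.

Lemma quadranceC (R : realType) (A B : plane R) :
  quadrance A B = quadrance B A.
Proof. by rewrite /quadrance; ring. Qed.

Lemma quadrance_eq0 (R : realType) (A B : plane R) :
  quadrance A B = 0 -> A = B.
Proof.
case: A B => [a1 a2] [b1 b2] /eqP; rewrite /quadrance /=.
rewrite paddr_eq0 ?sqr_ge0 // !sqrf_eq0 !subr_eq0.
by case/andP => /eqP -> /eqP ->.
Qed.

Lemma quadrance_neq0 (R : realType) (A B : plane R) :
  A <> B -> quadrance A B != 0.
Proof. by move=> AB; apply/eqP => /quadrance_eq0. Qed.

Lemma line_through_l (R : realType) (A B : plane R) : line_through A B A.
Proof. by exists 0; rewrite !mul0r !addr0 -surjective_pairing. Qed.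

Lemma line_through_r (R : realType) (A B : plane R) : line_through A B B.
Proof. by exists 1; rewrite !mul1r !subrKC -surjective_pairing. Qed.

Lemma collinear_through (R : realType) (A B C : plane R) :
  A <> B -> line_through A B C -> collinear A B C.
Proof.
move=> AB ABC; exists (line_through A B); split=> //.
- by exists A, B.
- exact: line_through_l.
- exact: line_through_r.
Qed.

Lemma collinear_diag (R : realType) (A C : plane R) : collinear A A C.
Proof.
have [<-|/eqP AC] := eqVneq A C; last first.
  exists (line_through A C); split; try exact: line_through_l.
    by exists A, C.
  exact: line_through_r.
(* All three points coincide: any second point spans a line through them. *)
have AB : A <> (A.1 + 1, A.2).
  move/(congr1 fst)/eqP => /=.
  by rewrite -subr_eq0 opprD addNKr oppr_eq0 oner_eq0.
exists (line_through A (A.1 + 1, A.2)); split; try exact: line_through_l.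
by exists A, (A.1 + 1, A.2).
Qed.

(** When [A <> B], the orthogonal projection of [C] on the line [AB] has
    parameter [(C - A) . (B - A) / quadrance A B]; the vanishing of the area
    says that [C] is its own projection. *)
Lemma collinear_of_area0 (R : realType) (A B C : plane R) :
  twice_signed_area A B C = 0 -> collinear A B C.
Proof.
have [<- _|/eqP AB] := eqVneq A B; first exact: collinear_diag.
move=> K0; apply: (collinear_through AB).
have := quadrance_neq0 AB; move: K0; rewrite /quadrance /twice_signed_area.
case: A B C {AB} => [a1 a2] [b1 b2] [c1 c2] /= K0 Q0.
exists (((c1 - a1) * (b1 - a1) + (c2 - a2) * (b2 - a2))
        / ((b1 - a1) ^+ 2 + (b2 - a2) ^+ 2)) => /=.
congr pair; apply: (mulIf Q0); apply/eqP; rewrite -subr_eq0; apply/eqP.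
- transitivity (- (b2 - a2) *
    ((b1 - a1) * (c2 - a2) - (b2 - a2) * (c1 - a1))); first by field.
  by rewrite K0 mulr0.
- transitivity ((b1 - a1) *
    ((b1 - a1) * (c2 - a2) - (b2 - a2) * (c1 - a1))); first by field.
  by rewrite K0 mulr0.
Qed.

Section Spread.
Variables (R : realType) (P A B : plane R).
Hypothesis area_neq0 : twice_signed_area P A B != 0.

Lemma vertex_neq_l : P <> A.
Proof.
move=> PA; move: area_neq0; rewrite -PA /twice_signed_area.
by rewrite !subrr !mul0r subrr eqxx.
Qed.

Lemma vertex_neq_r : P <> B.
Proof.
move=> PB; move: area_neq0; rewrite -PB /twice_signed_area.
by rewrite !subrr !mulr0 subrr eqxx.
Qed.

Lemma sides_meet_at_vertex X :
  line_through P A X -> line_through P B X -> X = P.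
Proof.
move=> [t ->] [u [e1 e2]].
have /eqP : t * twice_signed_area P A B = 0.
  transitivity ((P.1 + t * (A.1 - P.1) - P.1) * (B.2 - P.2)
    - (P.2 + t * (A.2 - P.2) - P.2) * (B.1 - P.1)).
    by rewrite /twice_signed_area; ring.
  by rewrite e1 e2; ring.
rewrite mulf_eq0 (negPf area_neq0) orbF => /eqP ->.
by rewrite !mul0r !addr0 -surjective_pairing.
Qed.

Lemma sides_not_parallel : ~ parallel (line_through P A) (line_through P B).
Proof.
case=> [lAB|l0].
- apply: vertex_neq_l; apply/esym/sides_meet_at_vertex.
    exact: line_through_r.
  by rewrite -lAB; exact: line_through_r.
- suff : (line_through P A `&` line_through P B)%classic P by rewrite l0.
  by split; exact: line_through_l.
Qed.

(** By Lagrange's identity the right-hand side is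
    [1 - (u . v) ^+ 2 / (|u| ^+ 2 * |v| ^+ 2)] with [u = A - P], [v = B - P].
    A point [P + t u] of the first side has its foot at
    [P + (t (u . v) / |v| ^+ 2) v], so the factor [t ^+ 2] cancels from the
    ratio of quadrances. *)
Lemma is_spread_at_vertex s :
  is_spread (line_through P A) (line_through P B) s <->
  s = twice_signed_area P A B ^+ 2 / (quadrance P A * quadrance P B).
Proof.
have QA := quadrance_neq0 vertex_neq_l.
have QB := quadrance_neq0 vertex_neq_r.
split=> [[[/sides_not_parallel //]|]|->].
- case=> _ [X [Y [Z [[lAX lBX] [lAY YX] [lBZ footZ] ->]]]].
  move: YX; rewrite (sides_meet_at_vertex lAX lBX) {X lAX lBX} => YP.
  have := footZ _ (line_through_r P B); have := footZ _ (line_through_l P B).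
  have := quadrance_neq0 (fun e => YP (esym e)).
  move: lAY lBZ => [t ->] [w ->]; move: QA QB.
  rewrite /quadrance /twice_signed_area /=.
  move=> QA QB QY orthP orthB.
  (* [Y - Z] is orthogonal to [B - P], the difference of the directions from
     [Z] to the two points of the second side. *)
  have ew : w = t * ((A.1 - P.1) * (B.1 - P.1) + (A.2 - P.2) * (B.2 - P.2))
              / ((B.1 - P.1) ^+ 2 + (B.2 - P.2) ^+ 2).
    apply: (mulIf QB); rewrite divfK //; apply/eqP; rewrite eq_sym -subr_eq0.
    by apply/eqP; rewrite -[RHS](subrr 0) -{1}orthB -orthP; ring.
  by rewrite ew; field; apply/and3P; split.
- right; split; first exact: sides_not_parallel.
  exists P, A.
  set w := ((A.1 - P.1) * (B.1 - P.1) + (A.2 - P.2) * (B.2 - P.2))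
           / quadrance P B.
  exists (P.1 + w * (B.1 - P.1), P.2 + w * (B.2 - P.2)).
  move: QA QB; rewrite /w {w} /quadrance /twice_signed_area => QA QB.
  split=> //=.
  + by split; exact: line_through_l.
  + split; first exact: line_through_r.
    by move=> /esym; exact: vertex_neq_l.
  + split; first by eexists.
    by move=> _ [t ->] /=; field.
  + by field; apply/andP; split.
Qed.

Lemma spread_at_vertex :
  spread (line_through P A) (line_through P B) =
  twice_signed_area P A B ^+ 2 / (quadrance P A * quadrance P B).
Proof.
apply/is_spread_at_vertex.
by apply: (@xgetPex _ 0 [set s | is_spread _ _ s]%classic); eexists;
  apply/is_spread_at_vertex.
Qed.

End Spread.

Lemma archimedes_formula (R : realType) (A B C : plane R) :
  (quadrance B C + quadrance A C + quadrance A B) ^+ 2 =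
  2 * (quadrance B C ^+ 2 + quadrance A C ^+ 2 + quadrance A B ^+ 2)
  + 4 * twice_signed_area A B C ^+ 2.
Proof. by rewrite /quadrance /twice_signed_area; ring. Qed.

Theorem theorem7 (R : realType) (A1 A2 A3 : plane R) (s1 s2 s3 : R)
  (triangle : ~ collinear A1 A2 A3)
  (hs1 : s1 = spread (line_through A1 A2) (line_through A1 A3))
  (hs2 : s2 = spread (line_through A2 A1) (line_through A2 A3))
  (hs3 : s3 = spread (line_through A3 A1) (line_through A3 A2)) :
  (s1 + s2 + s3) ^+ 2
    = 2 * (s1 ^+ 2 + s2 ^+ 2 + s3 ^+ 2) + 4 * s1 * s2 * s3.
Proof.
have K0 : twice_signed_area A1 A2 A3 != 0.
  by apply/eqP => /collinear_of_area0.
have K2 : twice_signed_area A2 A1 A3 != 0.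
  by rewrite twice_signed_area_swap oppr_eq0.
have K3 : twice_signed_area A3 A1 A2 != 0 by rewrite twice_signed_area_rot.
have Q3 := quadrance_neq0 (vertex_neq_l K0).
have Q2 := quadrance_neq0 (vertex_neq_r K0).
have Q1 := quadrance_neq0 (vertex_neq_r K2).
rewrite hs1 hs2 hs3 !spread_at_vertex //.
rewrite (twice_signed_area_swap A1 A2) sqrrN (twice_signed_area_rot A1 A2 A3).
rewrite (quadranceC A2 A1) (quadranceC A3 A1) (quadranceC A3 A2).
have := archimedes_formula A1 A2 A3.
move: (twice_signed_area _ _ _) Q1 Q2 Q3 => K.
move: (quadrance A2 A3) (quadrance A1 A3) (quadrance A1 A2).
move=> Q1 Q2 Q3 Q1n Q2n Q3n arch.
pose d := K ^+ 2 / (Q1 * Q2 * Q3).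
have -> : K ^+ 2 / (Q3 * Q2) = d * Q1.
  by rewrite /d; field; rewrite Q1n Q2n Q3n.
have -> : K ^+ 2 / (Q3 * Q1) = d * Q2.
  by rewrite /d; field; rewrite Q1n Q2n Q3n.
have -> : K ^+ 2 / (Q2 * Q1) = d * Q3.
  by rewrite /d; field; rewrite Q1n Q2n Q3n.
have dK : d * (Q1 * Q2 * Q3) = K ^+ 2.
  by rewrite /d divfK // !mulf_neq0.
transitivity (d ^+ 2 * (Q1 + Q2 + Q3) ^+ 2); first by ring.
by rewrite arch -dK; ring.
Qed.
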